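(* Let $n\ge 1$ and let $z_1,\dots,z_n$ be complex numbers of modulus $1$ (not necessarily distinct). Then there exists a complex number $z_0$ with $|z_0|=1$ such that \[ \sum_{j=1}^n \frac{1}{|z_0-z_j|^2}\le \frac{n^2}{4}. \] Moreover, the inequality is sharp for $z_1,\dots,z_n$, that is, \[ \min_{|z|=1}\ \sum_{j=1}^n \frac{1}{|z-z_j|^2}=\frac{n^2}{4}, \] if and only if the numbers $z_1,\dots,z_n$ are pairwise distinct and there exists $c\in\mathbb{C}$ with $|c|=1$ such that $z_j^n=c$ for all $j=1,\dots,n$.
   Context: The term $1/|z-z_j|^2$ is interpreted as $+\infty$ when $z=z_j$; in particular the point $z_0$ is different from every $z_j$. *)

(* Defs.v *)
From mathcomp Require Import all_boot all_order all_algebra.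
From mathcomp Require Import classical_sets reals constructive_ereal.
From mathcomp Require Import complex.

Set Implicit Arguments.
Unset Strict Implicit.
Unset Printing Implicit Defensive.

Import Order.TTheory GRing.Theory Num.Theory.
Import ComplexField.Normc.

Local Open Scope ring_scope.
Local Open Scope classical_set_scope.
Local Open Scope complex_scope.

(* [normc] is the R-valued modulus, whereas the norm [`| _ |] of [R[i]] takes
   its values in [R[i]]. *)
Definition unit_circle (R : realType) : set R[i] := [set w | normc w = 1].
Arguments unit_circle {R}.

(* The inverse is the one of extended reals, for which [0^-1 = +oo]: the sum is
   [+oo] as soon as [w] is one of the [z j]. *)
Definition inv_sqdist_sum (R : realType) (n : nat) (z : 'I_n -> R[i])
    (w : R[i]) : \bar R :=
  (\sum_(j < n) ((normc (w - z j) ^+ 2)%:E)^-1)%E.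

Definition is_minimum (d : Order.disp_t) (T : porderType d) (A : set T)
    (m : T) : Prop :=
  A m /\ lbound A m.

(* Main.v *)
(**
Let [p] be the product of the [X - z_j] and let [z] maximize [|p|] on the unit
circle. With [L = z p'(z) / p(z)], the sum [S] of the [1 / |z - z_j|^2] satisfies
[n L - L^2 - S = (n - 1) z p'(z) / p(z) - z^2 p''(z) / p(z)]; the real part of
[L] is [n/2], and its imaginary part vanishes because [z] is a critical point of
[|p|]. For a primitive [n]-th root of unity [w] and [0 <= m <= n],
[m (n - m) = \sum_(0 < k < n) 2 / |1 - w^k|^2 (1 - w^(k m))]. Applying this to
every monomial of [p] yields
[n^2/4 - S = \sum_(0 < k < n) 2 / |1 - w^k|^2 (1 - p(z w^k) / p(z))],
whose real part is nonnegative by maximality. In the equality case [p] takes the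
same value at all the [z w^k], so that [p = X^n - c].
*)
Require Import Defs.
From mathcomp Require Import all_boot all_order all_algebra.
From mathcomp Require Import all_classical all_reals all_analysis.
From mathcomp Require Import cyclic separable cyclotomic.
From mathcomp Require Import complex ring lra.
Set Implicit Arguments.
Unset Strict Implicit.
Unset Printing Implicit Defensive.
Import Order.TTheory GRing.Theory Num.Theory.
Local Open Scope ring_scope.

(** * Roots of unity and second differences *)

Lemma closed_prim_root_exists (C : numClosedFieldType) (n : nat) :
  (0 < n)%N -> exists w : C, n.-primitive_root w.
Proof.
move=> n_gt0; pose p : {poly C} := 'X^n - 1.
have [r Dp] := closed_field_poly_normal p.
move: Dp; rewrite lead_coefXnsubC // scale1r => Dp.
have sz_r : (n <= size r)%N.
  by rewrite -ltnS -(size_prod_XsubC r id) -Dp size_XnsubC.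
have rn1 : all n.-unity_root r by apply/allP=> z; rewrite -root_prod_XsubC -Dp.
have uniq_r : uniq r.
  by rewrite -separable_prod_XsubC -Dp separable_Xn_sub_1 // pnatr_eq0 -lt0n.
by have [w] := hasP (has_prim_root n_gt0 rn1 uniq_r sz_r); exists w.
Qed.

Lemma sum_prim_root_exp (F : fieldType) (n m : nat) (w : F) :
  n.-primitive_root w -> (0 < m < n)%N -> \sum_(k < n) (w ^+ k) ^+ m = 0.
Proof.
move=> w_prim /andP[m_gt0 m_ltn].
have wm_neq1 : w ^+ m - 1 != 0.
  rewrite subr_eq0 -(prim_order_dvd w_prim) gtnNdvd //.
apply: (mulfI wm_neq1); rewrite mulr0.
under eq_bigr => k _ do rewrite -exprM mulnC exprM.
by rewrite -subrX1 -exprM mulnC exprM (prim_expr_order w_prim) expr1n subrr.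
Qed.

(* Second differences determine a function up to an affine one, and the two
   boundary values fix the latter. *)
Lemma second_difference_parabola (F : numFieldType) (n : nat) (e : nat -> F) :
  e 0 = 0 -> e n = 0 ->
  (forall m, (m.+1 < n)%N -> e m.+2 - 2 * e m.+1 + e m = - 2) ->
  forall m, (m <= n)%N -> e m = m%:R * (n%:R - m%:R).
Proof.
move=> e0 en e2.
have H m : (m.+1 <= n)%N ->
    e m = m%:R * (e 1%N + 1 - m%:R) /\
    e m.+1 = m.+1%:R * (e 1%N + 1 - m.+1%:R).
  elim: m => [|m IH] lemn; first by rewrite e0; split; ring.
  have [Em Em1] := IH (ltnW lemn); split=> //.
  have /eqP := e2 m lemn; rewrite -subr_eq0 => /eqP H.
  have -> : e m.+2 = 2 * e m.+1 - e m - 2.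
    by apply/eqP; rewrite -subr_eq0 -H; apply/eqP; ring.
  by rewrite Em Em1 -!natr1; ring.
case: n en e2 H => [|n] en e2 H m le_mn.
  by move: le_mn; rewrite leqn0 => /eqP->; rewrite e0 mul0r.
have e1 : e 1%N + 1 = n.+1%:R.
  have [_ /esym/eqP] := H n (leqnn _).
  by rewrite en mulf_eq0 pnatr_eq0 /= subr_eq0 => /eqP.
case: m le_mn => [|m] le_mn; first by rewrite e0 mul0r.
by have [_ ->] := H m le_mn; rewrite e1.
Qed.

(** * Points on the unit circle and the Fejer weights *)

Section Circle.
Variable C : numClosedFieldType.
Implicit Types a z w x : C.

Lemma conj_norm1 z : `|z| = 1 -> z^* = z^-1.
Proof. by move=> z1; rewrite invC_norm z1 expr1n invr1 mul1r. Qed.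

Lemma norm1_neq0 z : `|z| = 1 -> z != 0.
Proof. by move=> z1; rewrite -normr_eq0 z1 oner_eq0. Qed.

(** On the circle conjugation is inversion, so squared distances become rational functions, within
    reach of [field]. *)
Lemma sqr_dist_circle z a : `|z| = 1 -> `|a| = 1 ->
  `|z - a| ^+ 2 = - (z - a) ^+ 2 / (z * a).
Proof.
move=> z1 a1; rewrite normCK rmorphB /= !conj_norm1 //.
by field; rewrite !norm1_neq0.
Qed.

Lemma norm_prim_root (n : nat) w : n.-primitive_root w -> `|w| = 1.
Proof.
move=> w_prim; have /eqP := congr1 Num.norm (prim_expr_order w_prim).
by rewrite normrX normr1 pexpr_eq1 ?(prim_order_gt0 w_prim) // => /eqP.
Qed.

(* The term [k = 0] contributes [2 / 0 = 0]. *)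
Lemma fejer_weight_sum (n m : nat) w : n.-primitive_root w -> (m <= n)%N ->
  \sum_(k < n) 2 / `|1 - w ^+ k| ^+ 2 * (1 - (w ^+ k) ^+ m)
    = m%:R * (n%:R - m%:R).
Proof.
move=> w_prim; have n_gt0 := prim_order_gt0 w_prim.
have wk1 k : `|w ^+ k| = 1 by rewrite normrX (norm_prim_root w_prim) expr1n.
apply: (second_difference_parabola
  (e := fun m => \sum_(k < n) 2 / `|1 - w ^+ k| ^+ 2 * (1 - (w ^+ k) ^+ m))).
- by rewrite big1 // => k _; rewrite expr0 subrr mulr0.
- rewrite big1 // => k _.
  by rewrite -exprM mulnC exprM (prim_expr_order w_prim) expr1n subrr mulr0.
move=> {}m m_ltn.
rewrite mulr_sumr -sumrB -big_split /=.
rewrite (bigD1 (Ordinal n_gt0)) //= expr0 !expr1n !subrr !mulr0.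
rewrite subr0 addr0 add0r.
(* With [x = w ^+ k], the second difference of [1 - x ^+ m] is [- x ^+ m * (1 - x) ^+ 2] and the
   weight is [- 2 * x / (1 - x) ^+ 2]. What remains is twice a vanishing power sum deprived of its
   term 1 at [k = 0]. *)
have -> : - 2 = \sum_(k < n | k != Ordinal n_gt0) 2 * (w ^+ k) ^+ m.+1.
  have := sum_prim_root_exp w_prim (m := m.+1) m_ltn.
  rewrite (bigD1 (Ordinal n_gt0)) //= expr0 expr1n -mulr_sumr => /eqP.
  by rewrite addrC addr_eq0 => /eqP->; rewrite mulrN mulr1.
apply: eq_bigr => k k_neq0.
have wk_neq1 : 1 - w ^+ k != 0.
  rewrite subr_eq0 eq_sym -[1](expr0 w) (eq_prim_root_expr w_prim) mod0n.
  by rewrite modn_small.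
rewrite sqr_dist_circle ?normr1 //.
have: w ^+ k != 0 by rewrite norm1_neq0.
move: wk_neq1; move: (w ^+ k) => x wk_neq1 x_neq0; rewrite !(exprS x).
by field; rewrite x_neq0 wk_neq1.
Qed.

(** * Logarithmic derivatives and the Fejer identity *)

Lemma horner_deriv_prod_XsubC (I : Type) (r : seq I) (a : I -> C) z
    (p := \prod_(j <- r) ('X - (a j)%:P)) : (forall j, z != a j) ->
  p^`().[z] = p.[z] * \sum_(j <- r) (z - a j)^-1 /\
  p^`(2).[z] = p.[z] * ((\sum_(j <- r) (z - a j)^-1) ^+ 2
                          - \sum_(j <- r) (z - a j)^-1 ^+ 2).
Proof.
move=> za; rewrite {}/p; elim: r => [|j r [IH1 IH2]].
  by rewrite !big_nil derivnS derivn1 !poly.derivE !hornerE /=; split; ring.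
rewrite derivnS derivn1 in IH2.
rewrite !big_cons derivnS derivn1 !poly.derivE !hornerE /= IH1 IH2 /=.
have zaj : z - a j != 0 by rewrite subr_eq0.
by split; field.
Qed.

(** Conjugation inverts [z] and [a], hence sends [z / (z - a)] to one minus itself. *)
Lemma half_plane_circle z a : `|z| = 1 -> `|a| = 1 -> z != a ->
  z / (z - a) = 2^-1 + 'i * 'Im (z / (z - a)).
Proof.
move=> z1 a1 za; rewrite [LHS]Crect; congr (_ + _).
have z0 := norm1_neq0 z1; have a0 := norm1_neq0 a1.
have za0 : z - a != 0 by rewrite subr_eq0.
have az0 : a - z != 0 by rewrite -oppr_eq0 opprB.
rewrite ReE rmorphM fmorphV rmorphB /= !conj_norm1 //.
have -> : z^-1 / (z^-1 - a^-1) = 1 - z / (z - a).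
  by field; rewrite za0 a0 z0 mulN1r az0.
by rewrite addrC subrK div1r.
Qed.

(** Each monomial is an eigenvector of [z^i d^i/dz^i], with a falling factorial as eigenvalue. *)
Lemma horner_derivn_coef (p : {poly C}) z (i : nat) :
  z ^+ i * p^`(i).[z] = \sum_(m < size p) p`_m * z ^+ m * (m ^_ i)%:R.
Proof.
rewrite -[in LHS](coefK p) poly_def linear_sum horner_sum mulr_sumr.
apply: eq_bigr => m _ /=; rewrite derivnZ derivnXn hornerZ hornerMn hornerXn.
have [lt_mi|le_im] := ltnP m i; first by rewrite ffact_small // !mulr0n !mulr0.
by rewrite -[in z ^+ m](subnKC le_im) exprD -mulr_natr; ring.
Qed.

(** Here [z] need not be a maximum, whence the squared sum of imaginary parts. After multiplication
    by [p.[z]], both sides weight the monomial of degree [m] by [m * (n - m)]. *)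
Lemma fejer_identity (n : nat) (a : 'I_n -> C) w z
    (p := \prod_j ('X - (a j)%:P)) :
  n.-primitive_root w -> `|z| = 1 -> (forall j, `|a j| = 1) ->
  (forall j, z != a j) ->
  \sum_(k < n) 2 / `|1 - w ^+ k| ^+ 2 * (1 - p.[z * w ^+ k] / p.[z])
    = n%:R ^+ 2 / 4 + (\sum_j 'Im (z / (z - a j))) ^+ 2
      - \sum_j (`|z - a j| ^+ 2)^-1.
Proof.
move=> w_prim z1 a1 za; have z0 := norm1_neq0 z1.
have za0 j : z - a j != 0 by rewrite subr_eq0.
have pz0 : p.[z] != 0.
  by rewrite horner_prod; apply/prodf_neq0 => j _; rewrite hornerXsubC.
have sz_p : size p = n.+1.
  by rewrite size_prod_XsubC /index_enum -enumT size_enum_ord.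
have [Dp D2p] := horner_deriv_prod_XsubC (index_enum 'I_n) za.
rewrite -/p in Dp D2p.
pose L := \sum_j z / (z - a j).
have -> : n%:R ^+ 2 / 4 + (\sum_j 'Im (z / (z - a j))) ^+ 2 = n%:R * L - L ^+ 2.
  have -> : L = n%:R / 2 + 'i * \sum_j 'Im (z / (z - a j)).
    rewrite /L (eq_bigr _ (fun j _ => half_plane_circle z1 (a1 j) (za j))).
    by rewrite big_split /= -mulr_sumr sumr_const card_ord [n%:R / 2]mulr_natl.
  have := sqrCi C; set s := \sum_j _ => i2.
  transitivity (n%:R ^+ 2 / 4 - 'i ^+ 2 * s ^+ 2); first by rewrite i2; ring.
  by field.
(* For [u = z / (z - a j)], the inverse squared distance is [u - u ^+ 2]. *)
have -> : \sum_j (`|z - a j| ^+ 2)^-1 = L - \sum_j (z / (z - a j)) ^+ 2.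
  rewrite -sumrB; apply: eq_bigr => j _; rewrite sqr_dist_circle //.
  by field; rewrite za0 z0 norm1_neq0.
have EL : L = z * \sum_j (z - a j)^-1 by rewrite mulr_sumr.
have EL2 : \sum_j (z / (z - a j)) ^+ 2 = z ^+ 2 * \sum_j (z - a j)^-1 ^+ 2.
  by rewrite mulr_sumr; apply: eq_bigr => j _; rewrite exprMn.
apply: (mulIf pz0).
transitivity (\sum_(m < n.+1) p`_m * z ^+ m * (m%:R * (n%:R - m%:R)));
  last first.
  have D1 := horner_derivn_coef p z 1; have D2 := horner_derivn_coef p z 2.
  rewrite sz_p in D1 D2.
  (* This uses [m * (n - m) = (n - 1) * m - m * (m - 1)]. *)
  transitivity ((n%:R - 1) * (z * p^`().[z]) - z ^+ 2 * p^`(2).[z]).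
    rewrite D2 -[z in z * _]expr1 -derivn1 D1 mulr_sumr -sumrB.
    apply: eq_bigr => m _; rewrite ffactn1 ffactnS ffactn1.
    case: (m : nat) => [|k]; first by rewrite mul0n; ring.
    by rewrite natrM /= -natr1; ring.
  by rewrite EL2 EL Dp D2p; ring.
transitivity (\sum_(k < n) 2 / `|1 - w ^+ k| ^+ 2 * (p.[z] - p.[z * w ^+ k])).
  rewrite mulr_suml; apply: eq_bigr => k _.
  by rewrite -[LHS]mulrA mulrBl mul1r divfK.
under eq_bigr => k _.
  rewrite !(horner_coef_wide (n := n.+1)) ?sz_p // -sumrB mulr_sumr.
  over.
rewrite exchange_big /=; apply: eq_bigr => m _.
have le_mn : (m <= n)%N by rewrite -ltnS.
rewrite -(fejer_weight_sum w_prim le_mn) mulr_sumr; apply: eq_bigr => k _.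
by rewrite exprMn; ring.
Qed.

(** * Criticality of a maximum on the circle *)

(** A nonzero linear term would change sign around 0; comparing small [s] and [- s] makes this
    quantitative, without limits. *)
Lemma poly_ge0_coef1 (p : {poly C}) :
  p`_0 = 0 -> (forall s, s \is Num.real -> 0 <= p.[s]) -> p`_1 = 0.
Proof.
move=> p0 p_ge0; set b := p`_1.
have [r Ep] : exists r, p = b *: 'X + 'X^2 * r.
  exists (drop_poly 2 p); rewrite -[LHS](poly_take_drop 2) mulrC; congr (_ + _).
  apply/polyP => -[|[|i]]; rewrite coef_take_poly coefZ coefX ?mulr0 ?mulr1 //=.
have [M rM] := poly_disk_bound r 1.
have M_ge0 : 0 <= M by apply: le_trans (rM 0 _); rewrite ?normr0.
(* The nonnegative numbers [b + s * r.[s]] and [- b + s * r.[- s]] add up to at most [2 * s * M],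
   which therefore bounds the first one. *)
have bound s : 0 < s -> s <= 1 -> `|b| <= 3 * s * M.
  move=> s_gt0 s_le1; have s_ge0 := ltW s_gt0.
  have rs : `|r.[s]| <= M by apply: rM; rewrite ger0_norm.
  have rNs : `|r.[- s]| <= M by apply: rM; rewrite normrN ger0_norm.
  have Hs : 0 <= b + s * r.[s].
    have := p_ge0 s (ger0_real s_ge0); rewrite Ep !hornerE.
    by rewrite (_ : _ + _ = s * (b + s * r.[s])) ?pmulr_rge0 //; ring.
  have HNs : 0 <= - b + s * r.[- s].
    have := p_ge0 (- s); rewrite realN => /(_ (ger0_real s_ge0)).
    rewrite Ep !hornerE.
    by rewrite (_ : _ + _ = s * (- b + s * r.[- s])) ?pmulr_rge0 //; ring.
  have H : `|b + s * r.[s]| <= 2 * s * M.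
    rewrite ger0_norm //.
    apply: (le_trans (y := s * (r.[s] + r.[- s]))).
      by rewrite -subr_ge0 (_ : _ - _ = - b + s * r.[- s]) //; ring.
    apply: (le_trans (real_ler_norm _)).
      have -> : s * (r.[s] + r.[- s]) =
        (b + s * r.[s]) + (- b + s * r.[- s]) by ring.
      by rewrite realD ?ger0_real.
    rewrite normrM (ger0_norm s_ge0) -mulrA mulrCA ler_pM2l // mulr_natl mulr2n.
    by rewrite (le_trans (ler_normD _ _)) // lerD.
  have -> : b = (b + s * r.[s]) - s * r.[s] by ring.
  apply: (le_trans (ler_normB _ _)).
  have -> : 3 * s * M = 2 * s * M + s * M by ring.
  by rewrite lerD // normrM (ger0_norm s_ge0) ler_wpM2l.
apply/eqP; apply: contraTT isT => b_neq0.
have b_gt0 : 0 < `|b| by rewrite normr_gt0.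
(* Taking [s] to be the modulus of [b] divided by [d], the bound would give [d <= 3 * M]. *)
pose d := `|b| + 3 * M.
have M3 : 0 <= 3 * M by rewrite mulr_ge0.
have d_gt0 : 0 < d by rewrite ltr_pwDl.
have /bound : 0 < `|b| / d by rewrite divr_gt0.
rewrite ler_pdivrMr // mul1r lerDl => /(_ M3).
rewrite mulrAC mulrA ler_pdivlMr // mulrC ler_pM2r // /d gerDr => H.
by have := lt_le_trans b_gt0 H; rewrite ltxx.
Qed.

Lemma coef_prod_1DX (n : nat) (b : 'I_n -> C)
    (q := \prod_j (1 + b j *: 'X)) : q`_0 = 1 /\ q`_1 = \sum_j b j.
Proof.
rewrite {}/q; elim: (index_enum _) => [|j r [IH0 IH1]].
  by rewrite !big_nil !coef1.
rewrite !big_cons coef0M coefM !big_ord_recr big_ord0 /= IH0 IH1.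
by rewrite !coefD !coef1 !coefZ !coefX /=; split; ring.
Qed.

(** Writing [y] for the imaginary part, [2 * z = (z - a) * (1 + 2 * 'i * y)]; hence the dependence
    on [s] is a real affine factor over [1 - 'i * s]. *)
Lemma cayley_factor z a s : `|z| = 1 -> `|a| = 1 -> z != a ->
  1 - 'i * s != 0 ->
  z * ((1 + 'i * s) / (1 - 'i * s)) - a
    = (z - a) * ((1 - 2 * s * 'Im (z / (z - a))) / (1 - 'i * s)).
Proof.
move=> z1 a1 za den_neq0; have za0 : z - a != 0 by rewrite subr_eq0.
have := half_plane_circle z1 a1 za; set y := 'Im _ => /(canRL (divfK za0)) Ez.
apply: (mulIf den_neq0).
have i2 : 'i * 'i = -1 :> C by rewrite -expr2 sqrCi.
transitivity ((z - a) + 'i * s * (2 * z - (z - a))); first by field.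
rewrite [in 2 * z]Ez.
transitivity ((z - a) * (1 + 2 * ('i * 'i) * s * y)); first by field.
by rewrite i2; field.
Qed.

(* On the circle, parametrized by [s |-> z * (1 + i s) / (1 - i s)], the
   polynomial [p] is up to the factor [p.[z] / (1 - i s) ^+ n] a real
   polynomial in [s]. *)
Lemma circle_maximum_critical (n : nat) (a : 'I_n -> C) z
    (p := \prod_j ('X - (a j)%:P)) :
  `|z| = 1 -> (forall j, `|a j| = 1) -> (forall j, z != a j) ->
  (forall w, `|w| = 1 -> `|p.[w]| <= `|p.[z]|) ->
  \sum_j 'Im (z / (z - a j)) = 0.
Proof.
move=> z1 a1 za pmax; pose y j := 'Im (z / (z - a j)).
have y_real j : y j \is Num.real by apply: Creal_Im.
pose q := \prod_j (1 + (- 2 * y j) *: 'X).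
have [q0 q1] := coef_prod_1DX (fun j => - 2 * y j); rewrite -/q in q0 q1.
pose d := \prod_(j < n) (1 + 'X^2 : {poly C}).
have d01 : d`_0 = 1 /\ d`_1 = 0.
  rewrite /d; elim: (index_enum _) => [|j r [IH0 IH1]].
    by rewrite big_nil !coef1.
  rewrite big_cons coef0M coefM !big_ord_recr big_ord0 /= IH0 IH1.
  by rewrite !coefD !coef1 !coefXn /=; split; ring.
(* Maximality at [s = 0] reads [q.[s] ^+ 2 <= (1 + s ^+ 2) ^+ n], with equality at 0. The linear
   coefficient of the difference is four times the sum of the [y j]. *)
have : (d - q ^+ 2)`_1 = 0.
  apply: poly_ge0_coef1.
    by rewrite coefB coef0M q0 d01.1 mulr1 subrr.
  move=> s s_real.
  have is_norm2 (t : C) : t \is Num.real -> `|1 + 'i * t| ^+ 2 = 1 + t ^+ 2.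
    by move=> t_real; rewrite normC2_rect ?real1 // expr1n.
  have pos_den (t : C) : t \is Num.real -> 0 < 1 + t ^+ 2.
    by move=> t_real; rewrite ltr_wpDr // real_exprn_even_ge0.
  have isN2 : `|1 - 'i * s| ^+ 2 = 1 + s ^+ 2.
    by rewrite -mulrN is_norm2 ?realN // sqrrN.
  have den_gt0 : 0 < `|1 - 'i * s|.
    rewrite lt_def normr_ge0 andbT -sqrf_eq0 isN2.
    by rewrite gt_eqF ?pos_den.
  have den_neq0 : 1 - 'i * s != 0 by rewrite -normr_gt0.
  pose w := z * ((1 + 'i * s) / (1 - 'i * s)).
  have w1 : `|w| = 1.
    rewrite normrM z1 mul1r normf_div.
    have -> : `|1 + 'i * s| = `|1 - 'i * s|.
      by apply/eqP; rewrite -(@eqrXn2 _ 2) // is_norm2 // isN2.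
    by rewrite divff // gt_eqF.
  have pw : p.[w] = p.[z] * q.[s] / (1 - 'i * s) ^+ n.
    rewrite !horner_prod -[n in _ ^+ n]card_ord -prodr_const.
    rewrite -big_split -prodf_div /=; apply: eq_bigr => j _.
    by rewrite !hornerE cayley_factor // -/(y j); field.
  have pz_gt0 : 0 < `|p.[z]|.
    rewrite normr_gt0 horner_prod; apply/prodf_neq0 => j _.
    by rewrite hornerXsubC subr_eq0.
  have := pmax w w1; rewrite pw normf_div normrM ler_pdivrMr; last first.
    by rewrite normr_gt0 expf_neq0.
  rewrite ler_pM2l // normrX => q_le.
  have q_real : q.[s] \is Num.real.
    rewrite horner_prod; apply: rpred_prod => j _; rewrite !hornerE.
    by rewrite realD ?real1 ?realM // realN realn.
  rewrite hornerD hornerN horner_exp subr_ge0 -real_normK //.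
  have -> : d.[s] = (`|1 - 'i * s| ^+ n) ^+ 2.
    rewrite exprAC isN2 horner_prod -[n in RHS]card_ord -prodr_const.
    by apply: eq_bigr => j _; rewrite !hornerE.
  by rewrite lerXn2r ?nnegrE ?exprn_ge0.
rewrite coefB d01.2 coefM !big_ord_recr big_ord0 /= q0 q1 -mulr_sumr => /eqP.
set Y := \sum_j _; rewrite (_ : 0 - _ = 4 * Y); last by ring.
by rewrite mulf_eq0 pnatr_eq0 /= => /eqP.
Qed.

(** * The bound at a maximum and the case of equality *)

Lemma horner_XnsubC (n : nat) c x : ('X^n - c%:P).[x] = x ^+ n - c.
Proof. by rewrite hornerD hornerN hornerXn hornerC. Qed.

(** The leading terms cancel in [p - q], so one point fewer than usual suffices. *)
Lemma monic_eq_on_roots (p q : {poly C}) (rs : seq C) :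
  p \is monic -> q \is monic -> size p = (size rs).+1 ->
  size q = (size rs).+1 -> uniq rs -> {in rs, forall x, p.[x] = q.[x]} ->
  p = q.
Proof.
move=> p_mon q_mon sz_p sz_q rs_uniq pq.
apply/eqP; rewrite -subr_eq0; apply/eqP.
apply: (roots_geq_poly_eq0 (rs := rs)) => //.
  by apply/allP => x /pq pqx; rewrite rootE !hornerE pqx subrr.
apply/leq_sizeP => j; rewrite leq_eqVlt coefB => /predU1P[<-|lt_j]; last first.
  by rewrite !nth_default ?sz_p ?sz_q ?subrr.
move: (monicP p_mon) (monicP q_mon); rewrite /lead_coef sz_p sz_q /= => -> ->.
by rewrite subrr.
Qed.

Lemma sum_inv_sqdist_maximum (n : nat) (a : 'I_n -> C) z
    (p := \prod_j ('X - (a j)%:P)) (S := \sum_j (`|z - a j| ^+ 2)^-1) :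
  (0 < n)%N -> `|z| = 1 -> (forall j, `|a j| = 1) ->
  (forall w, `|w| = 1 -> `|p.[w]| <= `|p.[z]|) ->
  [/\ forall j, z != a j, S <= n%:R ^+ 2 / 4 &
    S = n%:R ^+ 2 / 4 -> exists c : C, p = 'X^n - c%:P].
Proof.
move=> n_gt0 z1 a1 pmax.
have sz_p : size p = n.+1.
  by rewrite size_prod_XsubC /index_enum -enumT size_enum_ord.
have uniq_exp m (w : C) : m.-primitive_root w ->
    uniq [seq z * w ^+ k | k <- iota 0 m].
  move=> w_prim; rewrite map_inj_in_uniq ?iota_uniq // => i j.
  rewrite !mem_iota /= => lt_i lt_j /(mulfI (norm1_neq0 z1)) /eqP.
  by rewrite (eq_prim_root_expr w_prim) !modn_small // => /eqP.
(* Otherwise the maximum is 0 and [p], of degree [n], vanishes at [n.+1] points of the circle. *)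
have pz0 : p.[z] != 0.
  apply: contraTneq isT => pz0.
  have [w w_prim] := closed_prim_root_exists C (ltn0Sn n).
  have /(congr1 (fun q : {poly C} => size q)) : p = 0.
    apply: (roots_geq_poly_eq0 _ (uniq_exp _ _ w_prim)).
      apply/allP => _ /mapP[k _ ->]; rewrite rootE -normr_le0.
      rewrite (le_trans (pmax _ _)) ?pz0 ?normr0 // normrM normrX z1.
      by rewrite (norm_prim_root w_prim) expr1n mulr1.
    by rewrite size_map size_iota sz_p.
  by rewrite sz_p size_poly0.
have za j : z != a j.
  apply: contraNneq pz0 => zaj.
  by rewrite horner_prod (bigD1 j) //= hornerXsubC zaj subrr mul0r.
have [w w_prim] := closed_prim_root_exists C n_gt0.
pose t k := p.[z * w ^+ k] / p.[z].
have t_le1 k : `|t k| <= 1.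
  rewrite normf_div ler_pdivrMr ?normr_gt0 // mul1r pmax //.
  by rewrite normrM normrX z1 (norm_prim_root w_prim) expr1n mulr1.
have := fejer_identity w_prim z1 a1 za.
rewrite circle_maximum_critical // expr0n addr0 -/S -/p.
set D := n%:R ^+ 2 / 4 - S => fejer.
have D_real : D^* = D.
  apply: conj_Creal; rewrite realB ?ger0_real ?divr_ge0 ?exprn_ge0 //.
  by apply: sumr_ge0 => j _; rewrite invr_ge0 exprn_ge0.
(* [D] is real, so [D * 2] is [D] plus its conjugate; twice the real part of [1 - t k] splits into
   two terms, nonnegative because [t k] has modulus at most 1. *)
have twoD : D * 2 = \sum_(k < n)
    2 / `|1 - w ^+ k| ^+ 2 * (`|1 - t k| ^+ 2 + (1 - `|t k| ^+ 2)).
  rewrite mulr_natr mulr2n -{2}D_real -fejer rmorph_sum -big_split.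
  apply: eq_bigr => k _ /=; rewrite -/(t k) rmorphM rmorphB rmorph1 /=.
  rewrite (conj_Creal (ger0_real _)) ?divr_ge0 ?exprn_ge0 //.
  by rewrite !normCK rmorphB rmorph1 /=; ring.
have term_ge0 (k : 'I_n) : true ->
    0 <= 2 / `|1 - w ^+ k| ^+ 2 * (`|1 - t k| ^+ 2 + (1 - `|t k| ^+ 2)).
  move=> _; rewrite mulr_ge0 ?divr_ge0 ?exprn_ge0 // addr_ge0 ?exprn_ge0 //.
  by rewrite subr_ge0 expr_le1.
split=> //.
  by rewrite -subr_ge0 -/D -(pmulr_lge0 D (ltr0n C 2)) twoD sumr_ge0.
move=> /eqP; rewrite eq_sym -subr_eq0 -/D => /eqP D0.
have := psumr_eq0P term_ge0; rewrite -twoD D0 mul0r => /(_ erefl) term0.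
(* With this constant, ['X^n - c] takes the value [p.[z]] at every [z * w ^+ k]. *)
exists (z ^+ n - p.[z]).
apply: (monic_eq_on_roots _ _ _ _ (uniq_exp _ _ w_prim)).
- exact: monic_prod_XsubC.
- exact: monicXnsubC.
- by rewrite size_map size_iota.
- by rewrite size_map size_iota size_XnsubC.
move=> x /mapP[k]; rewrite mem_iota /= => lt_kn ->.
have -> : p.[z * w ^+ k] = p.[z].
  (* At [k = 0] the weight is 0 and [term0] gives nothing, but the point is [z] itself. *)
  case: k lt_kn => [|k] lt_kn; first by rewrite mulr1.
  have /eqP := term0 (Ordinal lt_kn) isT; rewrite !mulf_eq0 pnatr_eq0 /=.
  have wk_neq1 : 1 - w ^+ k.+1 != 0.
    rewrite subr_eq0 eq_sym -[1](expr0 w) (eq_prim_root_expr w_prim) mod0n.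
    by rewrite modn_small.
  rewrite invr_eq0 sqrf_eq0 normr_eq0 (negPf wk_neq1) /=.
  rewrite paddr_eq0 ?exprn_ge0 //.
    rewrite sqrf_eq0 normr_eq0 subr_eq0 => /andP[/eqP t1 _].
    by rewrite -[LHS](divfK pz0) -/(t _) -t1 mul1r.
  by rewrite subr_ge0 expr_le1.
rewrite horner_XnsubC exprMn -exprM mulnC exprM (prim_expr_order w_prim).
by rewrite expr1n mulr1 opprB addrC subrK.
Qed.

(** Since ['X^n - c] is constant on the [z * w ^+ k], the left side of [fejer_identity] vanishes and
    the sum exceeds the bound by a real square. *)
Lemma le_sum_inv_sqdist_unity (n : nat) (a : 'I_n -> C) c z :
  (0 < n)%N -> \prod_j ('X - (a j)%:P) = 'X^n - c%:P ->
  `|z| = 1 -> (forall j, `|a j| = 1) -> (forall j, z != a j) ->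
  n%:R ^+ 2 / 4 <= \sum_j (`|z - a j| ^+ 2)^-1.
Proof.
move=> n_gt0 Dp z1 a1 za; have [w w_prim] := closed_prim_root_exists C n_gt0.
have := fejer_identity w_prim z1 a1 za; rewrite big1 => [|k _].
  move/esym/eqP; rewrite subr_eq0 => /eqP <-.
  by rewrite lerDl real_exprn_even_ge0 // rpred_sum // => j _; apply: Creal_Im.
rewrite Dp !horner_XnsubC exprMn [(w ^+ k) ^+ n]exprAC.
rewrite (prim_expr_order w_prim) expr1n mulr1 divff ?subrr ?mulr0 //.
rewrite -horner_XnsubC -Dp horner_prod; apply/prodf_neq0 => j _.
by rewrite hornerXsubC subr_eq0.
Qed.

(** A repeated [a i] would be a zero of the derivative [n X^(n-1)], which has none on the circle.
    Conversely two monic polynomials of degree [n] vanish at the same [n] distinct points. *)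
Lemma prod_XsubC_unity (n : nat) (a : 'I_n -> C) :
  (0 < n)%N -> (forall j, `|a j| = 1) ->
  (exists c, \prod_j ('X - (a j)%:P) = 'X^n - c%:P) <->
  injective a /\ exists2 c, `|c| = 1 & forall j, a j ^+ n = c.
Proof.
move=> n_gt0 a1; set p := \prod_j _.
have prodE : p = \prod_(x <- codom a) ('X - x%:P).
  by rewrite big_image /=.
split=> [[c Dp]|[a_inj [c _ ac]]]; last first.
  exists c; apply: (@monic_eq_on_roots _ _ (codom a)).
  - exact: monic_prod_XsubC.
  - exact: monicXnsubC.
  - by rewrite prodE size_prod_XsubC.
  - by rewrite size_codom card_ord size_XnsubC.
  - by rewrite map_inj_uniq ?enum_uniq.
  move=> x x_a; have /eqP -> : root p x by rewrite prodE root_prod_XsubC.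
  by have [j ->] := codomP x_a; rewrite horner_XnsubC ac subrr.
have ac j : a j ^+ n = c.
  apply/eqP; rewrite -subr_eq0 -horner_XnsubC -Dp -rootE prodE root_prod_XsubC.
  exact: codom_f.
split; last first.
  by exists c => //; rewrite -(ac (Ordinal n_gt0)) normrX a1 expr1n.
move=> i j aij; apply/eqP; apply: contraTT isT => neq_ij.
have : p^`().[a i] = 0.
  rewrite /p (bigD1 i) // (bigD1 j) 1?eq_sym //= -aij !poly.derivE !hornerE.
  by rewrite subrr /=; ring.
rewrite Dp !poly.derivE subr0 hornerMn hornerXn => /eqP.
rewrite mulrn_eq0 expf_eq0 (negPf (norm1_neq0 (a1 i))) andbF.
by rewrite -leqn0 leqNgt n_gt0.
Qed.

End Circle.

(** * Existence of a maximum and extended real sums *)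

Local Open Scope classical_set_scope.
Local Open Scope complex_scope.
Import numFieldNormedType.Exports ComplexField.Normc.
Lemma normc_real (R : rcfType) (z : R[i]) : (normc z)%:C = `|z|.
Proof. by case: z. Qed.

Lemma normc_eq1 (R : rcfType) (z : R[i]) : normc z = 1 <-> `|z| = 1.
Proof.
rewrite -normc_real; split=> [->//|/eqP].
by rewrite (eq_complex _ 1%:C) /= eqxx andbT => /eqP.
Qed.

(** This reduces maximization over the circle to the extreme value theorem on a segment. *)
Lemma unit_circle_polar (R : realType) (z : R[i]) : normc z = 1 ->
  exists2 t : R, - pi <= t <= pi & z = cos t +i* sin t.
Proof.
case: z => x y /= /(congr1 (fun u => u ^+ 2)).
rewrite sqr_sqrtr ?addr_ge0 ?sqr_ge0 // expr1n => xy1.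
have x_bnd : -1 <= x <= 1.
  rewrite -ler_norml -(@expr_le1 _ 2) // real_normK ?num_real // -xy1.
  by rewrite lerDl sqr_ge0.
have y2 : 1 - x ^+ 2 = y ^+ 2 by rewrite -xy1 addrAC subrr add0r.
have acos_ge := acos_ge0 x_bnd; have acos_le := acos_lepi x_bnd.
have [y_ge0|y_lt0] := leP 0 y.
  exists (acos x).
    by rewrite acos_le andbT (le_trans _ acos_ge) // oppr_le0 pi_ge0.
  rewrite acosK ?in_itv //= sin_acos // y2 sqrtr_sqr ger0_norm //.
exists (- acos x).
  by rewrite lerN2 acos_le (le_trans _ (pi_ge0 R)) // oppr_le0.
rewrite cosN sinN acosK ?in_itv //= sin_acos // y2 sqrtr_sqr ltr0_norm //.
by rewrite opprK.
Qed.

Lemma circle_prod_maximum (R : realType) (n : nat) (a : 'I_n -> R[i]) :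
  exists2 z : R[i], normc z = 1 & forall w, normc w = 1 ->
    \prod_j `|w - a j| <= \prod_j `|z - a j|.
Proof.
pose e t : R[i] := cos t +i* sin t.
pose g (t : R) := \prod_j normc (e t - a j).
have g_cont : continuous g.
  apply: (@continuous_big R _ *%R 1 xpredT).
    by move=> [x y] /=; apply: mul_continuous.
  move=> j _ t; rewrite /e; case: (a j) => x y /=.
  apply: continuous_comp; last exact: sqrt_continuous.
  have sqr_cont (f : R -> R) c : continuous f ->
      {for t, continuous (fun s => (f s - c) ^+ 2)}.
    move=> f_cont.
    apply: (@continuous_comp _ _ _ (fun s => f s - c) (@GRing.exp R ^~ 2%N)).
      by apply: continuousB; [exact: f_cont|exact: cst_continuous].
    exact: exprn_continuous.
  apply: continuousD; apply: sqr_cont; first exact: continuous_cos.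
  exact: continuous_sin.
have pi_le : - pi <= pi :> R.
  by rewrite (le_trans _ (pi_ge0 R)) // oppr_le0 pi_ge0.
have [t _ tmax] := EVT_max pi_le (continuous_subspaceT g_cont).
exists (e t).
  by rewrite /e /= cos2Dsin2 sqrtr1.
have prodE w : \prod_j `|w - a j| = (\prod_j normc (w - a j))%:C.
  by rewrite rmorph_prod; apply: eq_bigr => j _; rewrite /= normc_real.
move=> w /unit_circle_polar[s s_pi ->]; rewrite !prodE lecR.
by apply: tmax; rewrite in_itv.
Qed.

Lemma inv_sqdist_sum_real (R : realType) (n : nat) (z : 'I_n -> R[i]) w :
  (forall j, w != z j) ->
  exists2 r : R, inv_sqdist_sum z w = r%:E &
    r%:C = \sum_j (`|w - z j| ^+ 2)^-1.
Proof.
move=> wz; exists (\sum_j (normc (w - z j) ^+ 2)^-1).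
  rewrite /inv_sqdist_sum -sumEFin; apply: eq_bigr => j _.
  rewrite inver sqrf_eq0 ifF //; apply: contraNF (wz j) => /eqP/eq0_normc.
  by move/eqP; rewrite subr_eq0.
rewrite rmorph_sum; apply: eq_bigr => j _ /=.
by rewrite fmorphV rmorphXn /= normc_real.
Qed.

Lemma inv_sqdist_sum_pole (R : realType) (n : nat) (z : 'I_n -> R[i]) j :
  inv_sqdist_sum z (z j) = +oo%E.
Proof.
apply/eqP; rewrite esum_eqy => [|i _].
  by apply/existsP; exists j; rewrite subrr normc0 expr0n inve0 eqxx.
by rewrite inver; case: ifP.
Qed.

Theorem mainTheorem1 (R : realType) (n : nat) (z : 'I_n -> R[i])
    (n_ge1 : (1 <= n)%N) (z_unit : forall j, unit_circle (z j)) :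
  (exists2 z0 : R[i], unit_circle z0 &
     (inv_sqdist_sum z z0 <= (n%:R ^+ 2 / 4%:R)%:E)%E)
  /\
  (is_minimum [set inv_sqdist_sum z w | w in unit_circle]
     (n%:R ^+ 2 / 4%:R)%:E
   <->
   injective z /\
   exists2 c : R[i], unit_circle c & forall j, z j ^+ n = c).
Proof.
have z1 j : `|z j| = 1 by apply/normc_eq1/z_unit.
have boundC : (n%:R ^+ 2 / 4%:R : R)%:C = n%:R ^+ 2 / 4 :> R[i].
  by rewrite rmorphM rmorphXn fmorphV !rmorph_nat.
have [z0 z0_unit z0_max] := circle_prod_maximum z.
pose p := \prod_j ('X - (z j)%:P).
have hornerE_norm w : `|p.[w]| = \prod_j `|w - z j|.
  by rewrite horner_prod normr_prod; apply: eq_bigr => j _; rewrite hornerXsubC.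
have z01 : `|z0| = 1 by apply/normc_eq1.
have [w w1|z0z le_S eq_S] := sum_inv_sqdist_maximum n_ge1 z01 z1.
  by rewrite !hornerE_norm; apply/z0_max/normc_eq1.
have [r Er rC] := inv_sqdist_sum_real z0z; rewrite -rC -boundC in le_S eq_S.
have le_z0 : (inv_sqdist_sum z z0 <= (n%:R ^+ 2 / 4%:R)%:E)%E.
  by rewrite Er lee_fin -lecR.
split; first by exists z0.
(* Both directions of the equivalence go through the form ['X^n - c] of [p]. *)
have unityP := prod_XsubC_unity n_ge1 z1; rewrite -/p in unityP.
have {unityP} -> : (injective z /\
    exists2 c : R[i], unit_circle c & forall j, z j ^+ n = c) <->
    (exists c, p = 'X^n - c%:P).
  rewrite unityP; split=> -[z_inj [c c1 zc]]; split=> //; exists c => //;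
  exact/normc_eq1.
split=> [[_ lb]|[c Dp]].
  (* The lower bound at [z0] meets [le_z0], which puts [z0] in the equality case. *)
  apply: eq_S; congr (_%:C); apply/eqP; rewrite eq_le -!lee_fin -Er le_z0 /=.
  by apply: lb; exists z0.
have le_w w : unit_circle w -> ((n%:R ^+ 2 / 4%:R)%:E <= inv_sqdist_sum z w)%E.
  move=> w_unit; have [/existsP[j /eqP ->]|] := boolP [exists j, w == z j].
    by rewrite inv_sqdist_sum_pole leey.
  rewrite negb_exists => /forallP wz.
  have [s -> sC] := inv_sqdist_sum_real wz.
  rewrite lee_fin -lecR boundC sC.
  by apply: (le_sum_inv_sqdist_unity n_ge1 Dp) => //; apply/normc_eq1.
split; last by move=> _ [w w_unit <-]; exact: le_w.
by exists z0 => //; apply/eqP; rewrite eq_le le_z0 le_w.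
Qed.
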